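(* Let $P$ be the transition matrix of an irreducible aperiodic $GI/G/1$-type Markov chain with blocks $A_k,B_k$ (as described in the context), and let $A=\sum_{k=-\infty}^{\infty}A_k$ be irreducible. Then the chain is strongly ergodic if and only if $A$ is not stochastic.
   Context: A $GI/G/1$-type Markov chain is a discrete-time Markov chain on the state space $\bigcup_{i\ge0}L_i$, $L_i=\{(i,j):j=1,\dots,m\}$, whose stochastic transition matrix $P$ has $m\times m$ blocks $P_{i,k}$ (transitions from level $i$ to level $k$) given by $P_{0,k}=B_k$ for $k\ge0$, $P_{i,0}=B_{-i}$ for $i\ge1$, and $P_{i,k}=A_{k-i}$ for $i,k\ge1$, where $A_k,B_k$ ($k\in\mathbb{Z}$) are nonnegative $m\times m$ matrices. Strongly (uniformly) ergodic means: there is a probability distribution $\pi$ on the state space such that $\sup_{(i,r)}\sum_{(j,s)}|P^n((i,r),(j,s))-\pi_{j,s}|\to0$ as $n\to\infty$. ''Stochastic'' means every row of $A$ sums to $1$. *)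

(* Defs.v *)
From HB Require Import structures.
From mathcomp Require Import all_boot all_order all_algebra.
From mathcomp Require Import all_classical all_reals all_analysis.
Import numFieldNormedType.Exports.
Import Order.TTheory GRing.Theory Num.Theory.

Set Implicit Arguments.
Unset Strict Implicit.
Unset Printing Implicit Defensive.

Local Open Scope classical_set_scope.
Local Open Scope ring_scope.

Section DiscreteChains.
Context {R : realType} {S : choiceType}.
Implicit Types (P : S -> S -> R) (pi : S -> R).

Definition is_distribution pi : Prop :=
  (forall x, 0 <= pi x) /\ (\esum_(x in [set: S]) (pi x)%:E = 1)%E.

Definition is_transition_matrix P : Prop := forall x, is_distribution (P x).

(* Valued in \bar R because esum is; the entries lie in [0, 1] whenever P is a
   transition matrix. *)
Fixpoint nstep P (n : nat) (x y : S) : \bar R :=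
  (if n is n'.+1 then \esum_(z in [set: S]) ((P x z)%:E * nstep P n' z y)
   else (x == y)%:R%:E)%E.

Definition chain_irreducible P : Prop :=
  forall x y, exists n, (0 < nstep P n x y)%E.

(* The gcd of the possible return times to x is 1: their only common divisor is
   1 (this fails, with d = 2, if there is no return time). *)
Definition aperiodic P : Prop :=
  forall (x : S) (d : nat),
    (forall n, (0 < n)%N -> (0 < nstep P n x x)%E -> (d %| n)%N) -> d = 1%N.

Definition strongly_ergodic P : Prop :=
  exists2 pi, is_distribution pi &
    (fun n => ereal_sup [set (\esum_(y in [set: S])
                                `| nstep P n x y - (pi y)%:E |)%E
                        | x in [set: S]]) @ \oo --> 0%E.

End DiscreteChains.

Section GIG1.
Context {R : realType} {m : nat}.
Implicit Types A B : int -> 'M[R]_m.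

(* The state (i, j) is phase j of level i; phases are numbered from 0. *)
Definition gig1_matrix A B (x y : nat * 'I_m) : R :=
  match x.1, y.1 with
  | 0%N, k => B k%:Z x.2 y.2
  | i.+1, 0%N => B (- (i.+1)%:Z) x.2 y.2
  | i.+1, k.+1 => A ((k.+1)%:Z - (i.+1)%:Z) x.2 y.2
  end.

(* Entrywise sum over all k in Z of nonnegative matrices. The sums are finite, so
   that fine is harmless, when gig1_matrix A B is a transition matrix: each
   partial sum is part of a row sum from a high enough level. *)
Definition block_sum A : 'M[R]_m :=
  \matrix_(i, j) fine (\esum_(k in [set: int]) (A k i j)%:E)%E.

Definition nonneg_mx (M : 'M[R]_m) : Prop := forall i j, 0 <= M i j.

(* For nonnegative M. As n = 0 is allowed, the 1 x 1 zero matrix is irreducible;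
   requiring n > 0 would change nothing else. *)
Definition irreducible_mx (M : 'M[R]_m) : Prop :=
  forall i j, exists n : nat, 0 < (M ^+ n) i j.

Definition stochastic_mx (M : 'M[R]_m) : Prop := forall i, \sum_j M i j = 1.

End GIG1.

(* Main.v *)
(** Write [M] for the sum of the [A k], which is substochastic. Started in phase [s],
    the chain avoids level 0 for [t] steps with probability at most
    [\sum_j (M ^+ t) s j], whatever the starting level. If [M] is irreducible and not
    stochastic, this is below 1 for some [t], so that level 0 is reached in bounded
    time with a probability bounded away from 0. As level 0 is finite, irreducibility
    and aperiodicity turn this into a minorization [eta <= P^K x x0] uniform in [x],
    and Doeblin's contraction of oscillations gives strong ergodicity.

    If [M] is stochastic, a chain started at level [i] is, after [n] steps, below any
    given level with a probability that tends to 0 as [i] grows, which rules out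
    convergence to a distribution uniformly in the starting state. *)

Require Import Defs.
From HB Require Import structures.
From mathcomp Require Import all_boot all_order all_algebra.
From mathcomp Require Import all_classical all_reals all_analysis.
From mathcomp Require Import lra zify.
Import numFieldNormedType.Exports.
Import Order.TTheory GRing.Theory Num.Theory.

Set Implicit Arguments.
Unset Strict Implicit.
Unset Printing Implicit Defensive.

Local Open Scope classical_set_scope.
Local Open Scope ring_scope.

(** * The Markov operator on bounded nonnegative functions *)

Section EsumFacts.
Context {R : realType} {S : choiceType}.
Implicit Types (f : S -> \bar R) (s : seq S).

Lemma le_sum_esum f s : uniq s -> (forall x, 0 <= f x)%E ->
  (\sum_(x <- s) f x <= \esum_(x in [set: S]) f x)%E.
Proof.
move=> us f0; apply: esum_ge; exists [set` s]; first by split.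
by rewrite -fsbig_seq.
Qed.

Lemma esum_le_sum f (c : \bar R) :
  (forall s, uniq s -> (\sum_(x <- s) f x <= c)%E) ->
  (\esum_(x in [set: S]) f x <= c)%E.
Proof.
move=> h; apply: ge_ereal_sup => _ [F [finF _] <-].
by rewrite fsbig_finite//; apply: h; exact: finmap.fset_uniq.
Qed.

Lemma esumZl f (c : R) : 0 <= c -> (forall x, 0 <= f x)%E ->
  (\esum_(x in [set: S]) (c%:E * f x) = c%:E * \esum_(x in [set: S]) f x)%E.
Proof.
(* Only [<=] needs a proof: used with the factor [c^-1] on the family [c * f], it also gives the
   converse. *)
have le (d : R) g : 0 <= d -> (forall x, 0 <= g x)%E ->
    (\esum_(x in [set: S]) (d%:E * g x) <= d%:E * \esum_(x in [set: S]) g x)%E.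
  move=> d0 g0; apply: esum_le_sum => s us.
  rewrite -ge0_sume_distrr//; apply: lee_wpmul2l; first by rewrite lee_fin.
  exact: le_sum_esum.
rewrite le_eqVlt => /predU1P[<- _|c0 f0].
  by rewrite mul0e; apply: esum1 => x _; rewrite mul0e.
apply/eqP; rewrite eq_le le ?(ltW c0)//=.
have cf0 x : (0 <= c%:E * f x)%E by rewrite mule_ge0// lee_fin ltW.
rewrite -lee_pdivlMl//; apply: le_trans (le _ _ _ cf0); last by rewrite invr_ge0 ltW.
apply: le_esum => x _.
by rewrite muleA -EFinM mulVf ?gt_eqF// mul1e.
Qed.

End EsumFacts.

(** * Expectation of a bounded nonnegative function *)

Section Expectation.
Context {R : realType} {S : choiceType}.
Implicit Types (p f g : S -> R) (s : seq S).

(** The class on which [expect] is finite, additive and positively homogeneous. Differences are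
    handled through complements [b - f], which stay in it. *)
Definition bounded_nonneg f := exists c, forall x, 0 <= f x <= c.

(* [fine] is harmless for bounded nonnegative [f] when [p] is a distribution:
   see [expectE]. *)
Definition expect p f : R := fine (\esum_(x in [set: S]) (p x * f x)%:E)%E.

Lemma bounded_nonneg_ge0 f x : bounded_nonneg f -> 0 <= f x.
Proof. by case=> c /(_ x) /andP[]. Qed.

Lemma bounded_nonneg_cst c : 0 <= c -> bounded_nonneg (fun=> c).
Proof. by move=> c0; exists c => x; rewrite c0 lexx. Qed.

Lemma bounded_nonneg_le f g : (forall x, 0 <= f x) -> (forall x, f x <= g x) ->
  bounded_nonneg g -> bounded_nonneg f.
Proof.
move=> f0 fg [c gc]; exists c => x; rewrite f0/=.
by apply: le_trans (fg x) _; case/andP: (gc x).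
Qed.

Lemma bounded_nonnegD f g : bounded_nonneg f -> bounded_nonneg g ->
  bounded_nonneg (fun x => f x + g x).
Proof.
move=> [c fc] [d gd]; exists (c + d) => x.
by case/andP: (fc x) => ? ?; case/andP: (gd x) => ? ?; rewrite addr_ge0// lerD.
Qed.

Lemma bounded_nonnegZ (c : R) f : 0 <= c -> bounded_nonneg f ->
  bounded_nonneg (fun x => c * f x).
Proof.
move=> c0 [d fd]; exists (c * d) => x.
by case/andP: (fd x) => ? ?; rewrite mulr_ge0// ler_wpM2l.
Qed.

Lemma bounded_nonneg_sum (I : Type) (r : seq I) (F : I -> S -> R) :
  (forall i, bounded_nonneg (F i)) -> bounded_nonneg (fun x => \sum_(i <- r) F i x).
Proof.
move=> bF; elim: r => [|i r IH].
  by exists 0 => x; rewrite big_nil lexx.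
rewrite (_ : (fun _ => _) = fun x => F i x + \sum_(i <- r) F i x).
  exact: bounded_nonnegD.
by apply/funext => x; rewrite big_cons.
Qed.

Lemma bounded_nonneg_bool (b : S -> bool) : bounded_nonneg (fun x => (b x)%:R).
Proof. by exists 1 => x; rewrite ler0n lern1 leq_b1. Qed.

Section OneDistribution.
Variables (p : S -> R) (p_distr : is_distribution p).

Let p0 x : 0 <= p x. Proof. by case: p_distr. Qed.

Lemma expectE f : bounded_nonneg f ->
  ((expect p f)%:E = \esum_(x in [set: S]) (p x * f x)%:E)%E.
Proof.
move=> bf; have [c fc] := bf.
(* [c] is known to be nonnegative only once a point of [S] is given; the maximum with 0 avoids
   choosing one. *)
have c0 : 0 <= Num.max c 0 by rewrite le_max lexx orbT.
rewrite fineK// ge0_fin_numE; last first.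
  by apply: esum_ge0 => x _; rewrite lee_fin mulr_ge0// bounded_nonneg_ge0.
apply: (@le_lt_trans _ _ (\esum_(x in [set: S]) ((Num.max c 0)%:E * (p x)%:E))%E).
  apply: le_esum => x _; rewrite -EFinM lee_fin mulrC ler_wpM2r//.
  by rewrite le_max; case/andP: (fc x) => _ ->.
by rewrite esumZl// p_distr.2 mule1 ltry.
Qed.

Lemma expect_ge0 f : bounded_nonneg f -> 0 <= expect p f.
Proof.
move=> bf; rewrite -lee_fin expectE//; apply: esum_ge0 => x _.
by rewrite lee_fin mulr_ge0// bounded_nonneg_ge0.
Qed.

Lemma le_expect f g : (forall x, 0 <= f x) -> (forall x, f x <= g x) ->
  bounded_nonneg g -> expect p f <= expect p g.
Proof.
move=> f0 fg bg; have bf := bounded_nonneg_le f0 fg bg.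
rewrite -lee_fin !expectE//; apply: le_esum => x _.
by rewrite lee_fin ler_wpM2l.
Qed.

Lemma expectD f g : bounded_nonneg f -> bounded_nonneg g ->
  expect p (fun x => f x + g x) = expect p f + expect p g.
Proof.
move=> bf bg; apply: EFin_inj; rewrite EFinD !expectE//; last exact: bounded_nonnegD.
rewrite -esumD; do ?by move=> x _; rewrite lee_fin mulr_ge0// bounded_nonneg_ge0.
by apply: eq_esum => x _; rewrite mulrDr EFinD.
Qed.

Lemma expectZ (c : R) f : 0 <= c -> bounded_nonneg f ->
  expect p (fun x => c * f x) = c * expect p f.
Proof.
move=> c0 bf; apply: EFin_inj; rewrite EFinM !expectE//; last exact: bounded_nonnegZ.
rewrite -esumZl//; last by move=> x; rewrite lee_fin mulr_ge0// bounded_nonneg_ge0.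
by apply: eq_esum => x _; rewrite -EFinM mulrCA.
Qed.

Lemma expect_cst (c : R) : 0 <= c -> expect p (fun=> c) = c.
Proof.
move=> c0; apply: EFin_inj; rewrite expectE; last exact: bounded_nonneg_cst.
under eq_esum do rewrite mulrC EFinM.
by rewrite esumZl// p_distr.2 mule1.
Qed.

End OneDistribution.

End Expectation.

(** * Iterates of the Markov operator and transition probabilities *)

Section MarkovOperator.
Context {R : realType} {S : choiceType}.
Variables (P : S -> S -> R) (P_trans : is_transition_matrix P).
Implicit Types (f g : S -> R) (s : seq S).

Definition markov_op f x := expect (P x) f.

(** The target comes first, so that [hit y] is an indicator function and [T n (hit y) x] is the
    [n]-step probability from [x] to [y]. *)
Definition hit (y : S) (x : S) : R := (x == y)%:R.

Local Notation T n := (iter n markov_op).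

Lemma markov_op_bounded f : bounded_nonneg f -> bounded_nonneg (markov_op f).
Proof.
move=> bf; have [c fc] := bf; exists (Num.max c 0) => x.
rewrite expect_ge0//=.
have c0 : 0 <= Num.max c 0 by rewrite le_max lexx orbT.
rewrite -[leRHS](expect_cst (P_trans x) c0).
apply: le_expect => //; last exact: bounded_nonneg_cst.
  by move=> z; exact: bounded_nonneg_ge0.
by move=> z; rewrite le_max; case/andP: (fc z) => _ ->.
Qed.

Lemma iter_markov_bounded n f : bounded_nonneg f -> bounded_nonneg (T n f).
Proof. by move=> bf; elim: n => //= n; exact: markov_op_bounded. Qed.

Lemma iter_markov_ge0 n f x : bounded_nonneg f -> 0 <= T n f x.
Proof. by move=> bf; apply: bounded_nonneg_ge0; exact: iter_markov_bounded. Qed.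

Lemma le_iter_markov n f g : (forall x, 0 <= f x) -> (forall x, f x <= g x) ->
  bounded_nonneg g -> forall x, T n f x <= T n g x.
Proof.
move=> f0 fg bg; elim: n => //= n IH x.
apply: le_expect => //; last exact: iter_markov_bounded.
move=> z; apply: iter_markov_ge0; exact: bounded_nonneg_le bg.
Qed.

Lemma iter_markovD n f g : bounded_nonneg f -> bounded_nonneg g ->
  T n (fun x => f x + g x) = fun x => T n f x + T n g x.
Proof.
move=> bf bg; elim: n => //= n ->; apply/funext => x.
by apply: expectD => //; exact: iter_markov_bounded.
Qed.

Lemma iter_markovZ n (c : R) f : 0 <= c -> bounded_nonneg f ->
  T n (fun x => c * f x) = fun x => c * T n f x.
Proof.
move=> c0 bf; elim: n => //= n ->; apply/funext => x.
by apply: expectZ => //; exact: iter_markov_bounded.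
Qed.

Lemma iter_markov_cst n (c : R) : 0 <= c -> T n (fun=> c) = fun=> c.
Proof.
by move=> c0; elim: n => //= n ->; apply/funext => x; exact: expect_cst.
Qed.

Lemma iter_markov_sum n (I : Type) (r : seq I) (F : I -> S -> R) x :
  (forall i, bounded_nonneg (F i)) ->
  T n (fun y => \sum_(i <- r) F i y) x = \sum_(i <- r) T n (F i) x.
Proof.
move=> bF; elim: r x => [|i r IH] x.
  rewrite big_nil (_ : (fun _ => _) = fun=> 0) ?iter_markov_cst//.
  by apply/funext => z; rewrite big_nil.
rewrite big_cons -IH (_ : (fun _ => _) = fun z => F i z + \sum_(i <- r) F i z).
  by rewrite iter_markovD//; exact: bounded_nonneg_sum.
by apply/funext => z; rewrite big_cons.
Qed.

(** The hypotheses amount to [a + c * hit y <= f] pointwise, and [T n] is monotone, linear and fixes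
    constants. *)
Lemma iter_markov_ge_hit n (a c : R) y f : 0 <= a -> 0 <= c -> bounded_nonneg f ->
  (forall x, a <= f x) -> a + c <= f y ->
  forall x, a + c * T n (hit y) x <= T n f x.
Proof.
move=> a0 c0 bf af acf x.
have bh : bounded_nonneg (hit y) by exact: bounded_nonneg_bool.
rewrite -[X in X + _](congr1 (fun h => h x) (iter_markov_cst n a0)).
rewrite -[X in _ + X](congr1 (fun h => h x) (iter_markovZ n c0 bh)).
rewrite -[leLHS](congr1 (fun h => h x) (iter_markovD n _ _)); last 2 first.
- exact: bounded_nonneg_cst.
- exact: bounded_nonnegZ.
apply: le_iter_markov => // z; first by rewrite addr_ge0// mulr_ge0// ler0n.
rewrite /hit; case: eqVneq => [->|_]; first by rewrite mulr1.
by rewrite mulr0 addr0.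
Qed.

Lemma iter_markov_compl n (b : R) f x : (forall x, 0 <= f x <= b) ->
  T n f x = b - T n (fun x => b - f x) x.
Proof.
move=> fb.
have b0 : 0 <= b by case/andP: (fb x) => /le_trans; exact.
have bf : bounded_nonneg f by exists b.
have bg : bounded_nonneg (fun x => b - f x).
  by exists b => z; case/andP: (fb z) => ? ?; rewrite subr_ge0 gerBl; apply/andP.
rewrite -[X in X - _](congr1 (fun h => h x) (iter_markov_cst n b0)).
rewrite (_ : (fun=> b) = fun x => f x + (b - f x)); last first.
  by apply/funext => z; rewrite subrKC.
by rewrite iter_markovD// addrK.
Qed.

Lemma nstepE n x y : nstep P n x y = (T n (hit y) x)%:E.
Proof.
elim: n x => [|n IH] x //=.
rewrite expectE//; last by apply: iter_markov_bounded; exact: bounded_nonneg_bool.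
by apply: eq_esum => z _; rewrite IH EFinM.
Qed.

Lemma nstep_total n x : (\esum_(y in [set: S]) nstep P n x y = 1)%E.
Proof.
elim: n x => [|n IH] x /=.
  rewrite (esumID [set x]); last by move=> y _; rewrite lee_fin ler0n.
  rewrite setTI setTI esum_set1 ?eqxx ?lee_fin// esum1 ?adde0// => y /eqP.
  by rewrite eq_sym => /negbTE ->.
have P0 x' z : 0 <= P x' z by case: (P_trans x').
have t0 z y : (0 <= nstep P n z y)%E.
  by rewrite nstepE lee_fin iter_markov_ge0//; exact: bounded_nonneg_bool.
have pt z y : (0 <= (P x z)%:E * nstep P n z y)%E by rewrite mule_ge0// lee_fin.
(* Tonelli: the double sum becomes a sum over pairs, which are swapped and then split again. *)
rewrite esum_esum// (reindex_esum ([set: S] `*`` (fun=> [set: S])) _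
  (fun z : S * S => (z.2, z.1))); last first.
  by split=> //= -[a b]; [move=> [c d] _ _ [-> ->]|exists (b, a)].
rewrite -(@esum_esum _ _ _ [set: S] (fun=> [set: S])
  (fun z y => (P x z)%:E * nstep P n z y)%E)//.
transitivity (\esum_(z in [set: S]) (P x z)%:E)%E; last by case: (P_trans x).
by apply: eq_esum => z _; rewrite esumZl// IH mule1.
Qed.

End MarkovOperator.

(** * Doeblin's theorem *)

Section Doeblin.
Context {R : realType} {S : choiceType}.
Variables (P : S -> S -> R) (P_trans : is_transition_matrix P).
Implicit Types (f g : S -> R) (s : seq S).

Local Notation T n := (iter n (markov_op P)).

Lemma iter_markov_between n (a b : R) f x : 0 <= a ->
  (forall x, a <= f x <= b) -> a <= T n f x <= b.
Proof.
move=> a0 fab.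
have f0 z : 0 <= f z by case/andP: (fab z) => az _; exact: le_trans az.
have b0 : 0 <= b by apply: le_trans (f0 x) _; case/andP: (fab x).
have bf : bounded_nonneg f by exists b => z; rewrite f0/=; case/andP: (fab z).
rewrite -{1}(congr1 (fun h => h x) (iter_markov_cst P_trans n a0)).
rewrite -{1}(congr1 (fun h => h x) (iter_markov_cst P_trans n b0)).
have bb : bounded_nonneg (fun=> b : R) := bounded_nonneg_cst b0.
by apply/andP; split; apply: le_iter_markov => // z; case/andP: (fab z).
Qed.

Variables (K : nat) (eta : R) (x0 : S).
Hypotheses (K_gt0 : (0 < K)%N) (eta_gt0 : 0 < eta)
  (minorization : forall x, eta <= T K (hit x0) x).

Local Notation rho := (1 - eta : R).

Let hit_bounded y : bounded_nonneg (hit y : S -> R).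
Proof. exact: bounded_nonneg_bool. Qed.

Let rho_ge0 : 0 <= rho.
Proof.
rewrite subr_ge0; apply: le_trans (minorization x0) _.
have h z : 0 <= (hit x0 z : R) <= 1 by rewrite ler0n lern1 leq_b1.
by case/andP: (iter_markov_between K x0 (lexx 0) h).
Qed.

Let rho_lt1 : rho < 1. Proof. by rewrite gtrBl. Qed.

(* With [c := f x0], both [f - a >= (c - a) * hit x0] and [b - f >= (b - c) * hit x0]
   are carried over by [T K]. *)
Lemma doeblin_contraction (a b : R) f : 0 <= a -> (forall x, a <= f x <= b) ->
  exists2 a', 0 <= a' & forall x, a' <= T K f x <= a' + rho * (b - a).
Proof.
move=> a0 fab.
have f0 z : 0 <= f z by case/andP: (fab z) => az _; exact: le_trans az.
have fb z : 0 <= f z <= b by rewrite f0/=; case/andP: (fab z).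
have bf : bounded_nonneg f by exists b.
have [af0 fb0] : a <= f x0 /\ f x0 <= b by case/andP: (fab x0).
exists (a + eta * (f x0 - a)).
  by rewrite addr_ge0// mulr_ge0 ?(ltW eta_gt0)// subr_ge0.
move=> x; apply/andP; split.
  apply: (@le_trans _ _ (a + (f x0 - a) * T K (hit x0) x)).
    by rewrite lerD2l mulrC ler_wpM2l// subr_ge0.
  apply: iter_markov_ge_hit => //; first by rewrite subr_ge0.
  - by move=> z; case/andP: (fab z).
  - by rewrite subrKC.
rewrite (iter_markov_compl P_trans K x fb).
have : (b - f x0) * eta <= T K (fun x => b - f x) x.
  apply: (@le_trans _ _ ((b - f x0) * T K (hit x0) x)).
    by rewrite ler_wpM2l// subr_ge0.
  rewrite -[leLHS]add0r; apply: iter_markov_ge_hit => //.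
  - by rewrite subr_ge0.
  - by exists b => z; case/andP: (fb z) => ? ?; rewrite subr_ge0 gerBl; apply/andP.
  - by move=> z; rewrite subr_ge0; case/andP: (fb z).
  - by rewrite add0r.
by lra.
Qed.

(** Each block of [K] steps shrinks the enclosing interval by the factor [rho]. Averaging never
    leaves an interval, so the one found at time [j * K] serves all later times. *)
Lemma doeblin_osc j f : (forall x, 0 <= f x <= 1) ->
  exists2 a, 0 <= a & forall n x, (j * K <= n)%N -> a <= T n f x <= a + rho ^+ j.
Proof.
move=> f01; elim: j => [|j [a a0 IH]].
  by exists 0 => // n x _; rewrite add0r expr0; exact: iter_markov_between.
have [|a' a'0 h] := @doeblin_contraction a (a + rho ^+ j) (T (j * K) f) a0.
  by move=> x; exact: IH.
exists a' => // n x jn.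
rewrite -(subnK jn) iterD mulSn iterD.
apply: iter_markov_between => // z.
by have := h z; rewrite [a + _]addrC addrK -exprS.
Qed.

(** Both values lie in the same interval of [doeblin_osc]. With [x = y] this is a Cauchy estimate in
    time; with [x] and [y] distinct it gives uniformity in the starting state. *)
Lemma doeblin_dist j f m n x y : (forall x, 0 <= f x <= 1) ->
  (j * K <= m)%N -> (j * K <= n)%N -> `|T m f x - T n f y| <= rho ^+ j.
Proof.
move=> f01 jm jn; have [a a0 h] := doeblin_osc j f01.
have := h m x jm; have := h n y jn.
by rewrite ler_norml => /andP[? ?] /andP[? ?]; apply/andP; split; lra.
Qed.

Lemma rho_small (e : R) : 0 < e -> exists j, rho ^+ j < e.
Proof.
move=> e0.
have /cvgrPdist_lt/(_ e e0) [j _ /(_ j (leqnn j))] : rho ^+ j @[j --> \oo] --> 0.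
  by apply: cvg_expr; rewrite ger0_norm.
by rewrite /= sub0r normrN ger0_norm ?exprn_ge0//; exists j.
Qed.

(** * The limit distribution and convergence in total variation *)

Definition doeblin_limit y : R := limn (fun n => T n (hit y) x0).

Lemma hit01 (y z : S) : 0 <= (hit y z : R) <= 1.
Proof. by rewrite ler0n lern1 leq_b1. Qed.

Lemma cvg_doeblin_limit y : T n (hit y) x0 @[n --> \oo] --> doeblin_limit y.
Proof.
apply: cauchy_cvg; apply: cauchy_exP => e e0.
have [j je] := rho_small e0.
exists (T (j * K) (hit y) x0); exists (j * K)%N => // n /= jn.
rewrite /ball/=; apply: le_lt_trans je.
by apply: doeblin_dist => //; exact: hit01.
Qed.

Lemma sum_hit01 s (z : S) : uniq s -> 0 <= \sum_(y <- s) (hit y z : R) <= 1.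
Proof.
move=> us; rewrite sumr_ge0/=; last by move=> y _; rewrite ler0n.
rewrite /hit -natr_sum lern1 (_ : (\sum_(y <- s) (z == y))%N = (z \in s))%N ?leq_b1//.
rewrite -count_uniq_mem// -sum1_count [RHS]big_mkcond/=.
by apply: eq_bigr => y _; rewrite eq_sym; case: eqP.
Qed.

(** The bound is independent of the size of [s]: the sum of the [hit y] is the indicator of [s], so
    [doeblin_dist] applies to it as a whole before the second time tends to infinity. *)
Lemma doeblin_limit_sum s n x j : uniq s -> (j * K <= n)%N ->
  `|\sum_(y <- s) T n (hit y) x - \sum_(y <- s) doeblin_limit y| <= rho ^+ j.
Proof.
move=> us jn.
have c : (\sum_(y <- s) T n (hit y) x - \sum_(y <- s) T m (hit y) x0)
    @[m --> \oo] --> \sum_(y <- s) T n (hit y) x - \sum_(y <- s) doeblin_limit y.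
  apply: cvgB; first exact: cvg_cst.
  apply: cvg_big => [|y _]; [exact: add_continuous|exact: cvg_doeblin_limit].
rewrite -(cvg_lim _ (cvg_norm c))//; apply: limr_le.
  by apply/cvg_ex; eexists; exact: cvg_norm c.
exists (j * K)%N => // m /= jm.
rewrite -!(iter_markov_sum P_trans)//.
apply: doeblin_dist => // z; exact: sum_hit01.
Qed.


Lemma doeblin_limit_ge0 y : 0 <= doeblin_limit y.
Proof.
apply: limr_ge; first by apply/cvg_ex; eexists; exact: cvg_doeblin_limit.
by apply: nearW => n; exact: iter_markov_ge0.
Qed.

(** No mass escapes: over every finite set, the limit is within [rho ^+ j] of the law at time
    [j * K], whose total is 1. *)
Lemma doeblin_limit_esum : (\esum_(y in [set: S]) (doeblin_limit y)%:E = 1)%E.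
Proof.
apply/eqP; rewrite eq_le; apply/andP; split; apply/lee_addgt0Pr => e e0;
  have [j je] := rho_small e0.
  apply: esum_le_sum => s us; rewrite sumEFin -EFinD lee_fin.
  have := doeblin_limit_sum x0 us (leqnn (j * K)).
  rewrite -(iter_markov_sum P_trans)// ler_norml => /andP[+ _].
  have /andP[_] := iter_markov_between (j * K) x0 (lexx 0) (fun z => sum_hit01 z us).
  by lra.
rewrite -(nstep_total P_trans (j * K) x0); apply: esum_le_sum => s us.
under eq_bigr do rewrite (nstepE P_trans).
have := doeblin_limit_sum x0 us (leqnn (j * K)).
rewrite ler_norml sumEFin => /andP[_ h].
apply: (@le_trans _ _ ((\sum_(y <- s) doeblin_limit y)%:E + e%:E)%E).
  by rewrite -EFinD lee_fin; lra.
rewrite leeD2r// -sumEFin; apply: le_sum_esum => // y.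
by rewrite lee_fin doeblin_limit_ge0.
Qed.

(** A finite set of states is split by the sign of the difference. On each part the absolute values
    sum to the absolute value of the sum, at most [rho ^+ j]; hence the factor 2. *)
Lemma doeblin_total_variation j n x : (j * K <= n)%N ->
  (\esum_(y in [set: S]) `| nstep P n x y - (doeblin_limit y)%:E |
     <= (2 * rho ^+ j)%:E)%E.
Proof.
move=> jn; apply: esum_le_sum => s us.
under eq_bigr do rewrite (nstepE P_trans) -EFinB.
pose d y := T n (hit y) x - doeblin_limit y.
rewrite (eq_bigr (fun y => (`|d y|)%:E))// sumEFin lee_fin.
have part (b : pred S) : `|\sum_(y <- s | b y) d y| <= rho ^+ j.
  by rewrite -big_filter sumrB doeblin_limit_sum// filter_uniq.
rewrite (bigID (fun y => 0 <= d y))/= mulr_natl mulr2n.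
apply: lerD; first apply: le_trans (part (fun y => 0 <= d y)).
  rewrite (eq_bigr d) ?ler_norm// => y d0; exact: ger0_norm.
apply: le_trans (part (fun y => ~~ (0 <= d y))).
rewrite (eq_bigr (fun y => - d y)) ?sumrN; last first.
  by move=> y; rewrite -ltNge => d0; exact: ltr0_norm.
by rewrite -normrN ler_norm.
Qed.

Lemma doeblin_strongly_ergodic : strongly_ergodic P.
Proof.
exists doeblin_limit.
  by split; [exact: doeblin_limit_ge0|exact: doeblin_limit_esum].
(* [n %/ K] counts the complete blocks of [K] steps among [n]. *)
apply: (@squeeze_cvge _ \oo _ _ (cst 0%E) _ (fun n => (2 * rho ^+ (n %/ K))%:E)).
- apply: nearW => n; apply/andP; split.
    apply: ereal_sup_ge; eexists; first by exists x0.
    by apply: esum_ge0 => y _; exact: abse_ge0.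
  apply: ge_ereal_sup => _ [x _ <-].
  by apply: doeblin_total_variation; exact: leq_trunc_div.
- exact: cvg_cst.
apply: cvg_EFin; first exact: nearW.
rewrite -[X in _ --> X](mulr0 2); apply: cvgMr.
apply: (@cvg_comp _ _ _ (divn^~ K) (fun j => rho ^+ j)); first exact: cvg_divnr.
by apply: cvg_expr; rewrite ger0_norm.
Qed.

End Doeblin.

(** * Uniform positivity on finite sets *)

(** The least positive difference of two members divides every member, so it is 1. Two consecutive
    members [b] and [b.+1] then generate all numbers from [b * b] on. *)
Lemma numerical_semigroup (D : nat -> Prop) :
  D 0%N -> (forall a b, D a -> D b -> D (a + b)%N) ->
  (forall d, (forall n, (0 < n)%N -> D n -> (d %| n)%N) -> d = 1%N) ->
  exists M, forall n, (M <= n)%N -> D n.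
Proof.
move=> D0 DD gcd1.
have DM k a : D a -> D (k * a)%N.
  by move=> Da; elim: k => // k IH; rewrite mulSn; exact: DD.
pose Q d := `[< (0 < d)%N /\ exists2 b, D b & D (b + d)%N >].
(* A positive member is its own difference with 0; without any positive member, 2 would vacuously be
   a common divisor. *)
have exQ : exists d, Q d.
  apply: contrapT => noQ; have // : 2 = 1%N.
  apply: gcd1 => n n0 Dn; case: noQ; exists n; apply/asboolP; split => //.
  by exists 0%N.
case: (ex_minnP exQ) => d /asboolP[d0 [b Db Dbd]] dmin.
have d1 : d = 1%N.
  apply: gcd1 => n n0 Dn; rewrite /dvdn -leqn0 leqNgt; apply/negP => r0.
  (* With [q = n %/ d], the members [q * (b + d)] and [n + q * b] differ by [n %% d], which is too
     small. *)
  have /dmin : Q (n %% d)%N.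
    apply/asboolP; split => //; exists (n %/ d * (b + d))%N; first exact: DM.
    have -> : (n %/ d * (b + d) + n %% d = n + n %/ d * b)%N.
      have := divn_eq n d; move: (n %/ d)%N (n %% d)%N => q r ->.
      by rewrite mulnDr; lia.
    by apply: DD => //; exact: DM.
  by rewrite leqNgt ltn_pmod.
exists (b * b)%N => n bn.
(* As [D b] and [D b.+1], write [n = q * b + r] as [(q - r) * b + r * b.+1]. *)
have [b0|b0] := posnP b.
  by move: Dbd; rewrite b0 d1 => /(DM n); rewrite muln1.
have qb : (b <= n %/ b)%N by rewrite leq_divRL.
have rq : (n %% b <= n %/ b)%N by apply: leq_trans qb; rewrite ltnW// ltn_pmod.
have -> : n = ((n %/ b - n %% b) * b + n %% b * (b + d))%N.
  rewrite d1 mulnDr addnA -mulnDl subnK// muln1; exact: divn_eq.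
by apply: DD; exact: DM.
Qed.

Lemma fin_eventually (I : finType) (Q : I -> nat -> Prop) :
  (forall i, exists M, forall n, (M <= n)%N -> Q i n) ->
  exists M, forall i n, (M <= n)%N -> Q i n.
Proof.
move=> /(@choice _ _ _) [F FQ]; exists (\max_i F i) => i n Mn.
by apply: FQ; apply: leq_trans Mn; exact: leq_bigmax.
Qed.

Lemma fin_pos_lower_bound (R : realType) (I : finType) (F : I -> R) :
  (forall i, 0 < F i) -> exists2 e, 0 < e & forall i, e <= F i.
Proof.
(* The initial value 1 keeps the bound positive when [I] is empty. *)
move=> F0; exists (\big[Num.min/1]_i F i); first exact: lt_bigmin.
by move=> i; exact: bigmin_le_cond.
Qed.

Section Positivity.
Context {R : realType} {S : choiceType}.
Variables (P : S -> S -> R) (P_trans : is_transition_matrix P).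

Local Notation T n := (iter n (markov_op P)).

(** Only the paths that are at [z] at time [n] are kept. *)
Lemma chapman_kolmogorov_ge n k x y z :
  T n (hit z) x * T k (hit y) z <= T (n + k) (hit y) x.
Proof.
have bh w : bounded_nonneg (hit w : S -> R) by exact: bounded_nonneg_bool.
rewrite iterD mulrC -[leLHS]add0r; apply: iter_markov_ge_hit => //.
- exact: iter_markov_ge0.
- exact: iter_markov_bounded.
- by move=> w; exact: iter_markov_ge0.
- by rewrite add0r.
Qed.

(** The return times to [y] form a numerical semigroup; a path of length [k] from [x] to [y] is put
    in front. *)
Lemma eventually_positive (P_irr : chain_irreducible P) (P_aper : aperiodic P) x y :
  exists M, forall n, (M <= n)%N -> 0 < T n (hit y) x.
Proof.
have irr u v : exists n, 0 < T n (hit v) u.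
  by have [n] := P_irr u v; rewrite nstepE// lte_fin; exists n.
have [k xk] := irr x y.
have [||d dh|M hM] := @numerical_semigroup (fun n => 0 < T n (hit y) y).
- by rewrite /= /hit eqxx.
- move=> a b ya yb; apply: lt_le_trans (chapman_kolmogorov_ge a b y y y).
  exact: mulr_gt0.
- by apply: (P_aper y) => n n0; rewrite nstepE// lte_fin; exact: dh.
exists (k + M)%N => n kn.
have -> : n = (k + (n - k))%N by rewrite subnKC// (leq_trans _ kn)// leq_addr.
apply: lt_le_trans (chapman_kolmogorov_ge k (n - k) x y y).
by rewrite mulr_gt0// hM// leq_subRL// (leq_trans _ kn)// leq_addr.
Qed.

(** A whole window of times is covered because the number of steps left after reaching level 0
    varies. *)
Lemma eventually_positive_fin (I : finType) (x : I -> S) y N :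
  chain_irreducible P -> aperiodic P ->
  exists M e, 0 < e /\
    forall i n, (M <= n <= M + N)%N -> e <= T n (hit y) (x i).
Proof.
move=> P_irr P_aper.
have [M hM] := fin_eventually (fun i => eventually_positive P_irr P_aper (x i) y).
pose F (u : I * 'I_N.+1) := T (M + u.2) (hit y) (x u.1).
have [|e e0 eF] := @fin_pos_lower_bound R _ F.
  by move=> u; apply: hM; exact: leq_addr.
exists M, e; split=> // i n /andP[Mn nMN].
have nN : (n - M < N.+1)%N by rewrite ltnS leq_subLR.
by have := eF (i, Ordinal nN); rewrite /F/= subnKC.
Qed.

End Positivity.

(** * Comparison with the sum of the blocks *)

Lemma esum_level_phase (R : realType) (m : nat) (g : nat * 'I_m -> \bar R) :
  (forall x, 0 <= g x)%E ->
  (\esum_(x in [set: nat * 'I_m]) g x =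
   \sum_(j < m) \esum_(k in [set: nat]) g (k, j))%E.
Proof.
move=> g0.
have split x : g x = (\sum_(j < m) if x \in [set x | x.2 = j] then g x else 0)%E.
  rewrite (bigD1 x.2)//= mem_set// big1 ?adde0// => j /negP jx.
  by rewrite memNset// => xj; apply: jx; rewrite xj.
rewrite (eq_esum (fun x _ => split x)) esum_sum; last first.
  by move=> x j _ _; case: ifP.
apply: eq_bigr => j _; rewrite -esum_mkcond.
rewrite (reindex_esum [set: nat] _ (fun k => (k, j)))//; split => //=.
- by move=> k l _ _ [].
- by move=> [k _] /= ->; exists k.
Qed.

Section GIG1Chain.
Context {R : realType} {m : nat}.
Variables (A B : int -> 'M[R]_m).
Hypotheses (A_ge0 : forall k, nonneg_mx (A k)).

Local Notation P := (gig1_matrix A B).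
Local Notation S := (nat * 'I_m)%type.

Hypothesis P_trans : is_transition_matrix P.

Local Notation T n := (iter n (markov_op P)).
Local Notation M := (block_sum A).

Lemma gig1_matrix_up (i k : nat) s j : (0 < i)%N -> (0 < k)%N ->
  P (i, s) (k, j) = A (k%:Z - i%:Z) s j.
Proof. by case: i => // i; case: k. Qed.

Let P0 x y : 0 <= P x y. Proof. by case: (P_trans x). Qed.

(* From a high enough level, none of the jumps in [l] is cut off by the boundary. *)
Lemma sum_jumps_le_expect (l : seq int) (L i : nat) s : uniq l ->
  (forall z : int, z \in l -> (`|z| + L < i)%N) ->
  \sum_j \sum_(z <- l) A z s j <= expect (P (i, s)) (fun x => (L < x.1)%N%:R).
Proof.
move=> ul li; rewrite -lee_fin expectE//; last first.
  exact: (@bounded_nonneg_bool _ _ (fun x : S => L < x.1)%N).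
rewrite esum_level_phase => [|x]; last by rewrite lee_fin mulr_ge0.
rewrite -sumEFin; apply: lee_sum => j _.
(* The level reached by the jump [z]. The absolute value only serves to land in [nat]: [i + z]
   exceeds [L] for [z] in [l]. *)
pose h (z : int) := `|(i%:Z + z)%R|%N.
have hE z : z \in l -> (h z)%:Z = i%:Z + z by move=> /li; rewrite /h; lia.
have -> : ((\sum_(z <- l) A z s j)%:E =
    \sum_(k <- map h l) (P (i, s) (k, j) * (L < k)%N%:R)%:E)%E.
  rewrite big_map -sumEFin; apply: eq_big_seq => z zl.
  have := hE z zl; have := li z zl => iz hz.
  have Lh : (L < h z)%N by move: iz hz; lia.
  rewrite Lh mulr1 gig1_matrix_up ?(leq_ltn_trans _ iz) ?(leq_ltn_trans _ Lh)//.
  by rewrite hz addrC addKr.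
apply: (le_sum_esum (f := fun k => (P (i, s) (k, j) * (L < k)%N%:R)%:E)) => [|k].
  rewrite map_inj_in_uniq// => z z' zl z'l /(congr1 Posz).
  by rewrite !hE// => /addrI.
by rewrite lee_fin mulr_ge0.
Qed.

Lemma jumps_bounded (l : seq int) L :
  exists I, forall i z, (I <= i)%N -> z \in l -> (`|z| + L < i)%N.
Proof.
exists (\max_(z <- l) `|z| + L).+1%N => i z Ii zl.
apply: leq_trans Ii; rewrite ltnS leq_add2r.
exact: leq_bigmax_seq.
Qed.

Lemma sum_jumps_le1 (l : seq int) s : uniq l -> \sum_j \sum_(z <- l) A z s j <= 1.
Proof.
move=> ul; have [i li] := jumps_bounded l 0.
apply: le_trans (sum_jumps_le_expect s ul (fun z => li i z (leqnn i))) _.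
rewrite -[leRHS](expect_cst (P_trans (i, s)) ler01).
apply: le_expect => //; last exact: bounded_nonneg_cst.
by move=> x; rewrite lern1 leq_b1.
Qed.

Lemma block_sumE i j : ((M i j)%:E = \esum_(k in [set: int]) (A k i j)%:E)%E.
Proof.
rewrite mxE fineK// ge0_fin_numE; last by apply: esum_ge0 => k _; rewrite lee_fin A_ge0.
apply: (@le_lt_trans _ _ 1%E); last exact: ltry.
apply: esum_le_sum => l ul; rewrite sumEFin lee_fin.
apply: le_trans (sum_jumps_le1 i ul).
rewrite (bigD1 j)//= lerDl; apply: sumr_ge0 => k _; apply: sumr_ge0 => z _.
exact: A_ge0.
Qed.

Lemma block_sum_ge0 : nonneg_mx M.
Proof.
move=> i j; rewrite -lee_fin block_sumE; apply: esum_ge0 => k _.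
by rewrite lee_fin A_ge0.
Qed.

Lemma block_sum_row s :
  ((\sum_j M s j)%:E = \esum_(z in [set: int]) (\sum_j A z s j)%:E)%E.
Proof.
under [RHS]eq_esum do rewrite -sumEFin.
rewrite esum_sum => [|z j _ _]; last by rewrite lee_fin A_ge0.
by rewrite -sumEFin; apply: eq_bigr => j _; exact: block_sumE.
Qed.

Lemma block_sum_substochastic s : \sum_j M s j <= 1.
Proof.
rewrite -lee_fin block_sum_row; apply: esum_le_sum => l ul.
by rewrite sumEFin lee_fin exchange_big; exact: sum_jumps_le1.
Qed.

(** The value 0 on level 0 kills the chain there, so that only paths avoiding that level are
    counted. *)
Definition above_zero (c : 'I_m -> R) (x : S) : R := if x.1 is 0%N then 0 else c x.2.

Lemma above_zero_bounded c : (forall s, 0 <= c s) -> bounded_nonneg (above_zero c).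
Proof.
move=> c0; exists (\sum_s c s) => -[[|k] s] /=.
  by rewrite lexx sumr_ge0.
rewrite c0/= /above_zero /= (bigD1 s)//= lerDl; exact: sumr_ge0.
Qed.

(* Forbidding level 0 only loses mass compared with the free phase process. *)
Lemma markov_above_zero_le c i s : (forall s, 0 <= c s) ->
  markov_op P (above_zero c) (i.+1, s) <= \sum_j M s j * c j.
Proof.
move=> c0; have bc := above_zero_bounded c0.
have az0 x : 0 <= above_zero c x by exact: bounded_nonneg_ge0.
rewrite -lee_fin expectE// esum_level_phase => [|x]; last by rewrite lee_fin mulr_ge0.
rewrite -sumEFin; apply: lee_sum => j _; apply: esum_le_sum => l ul.
rewrite sumEFin lee_fin.
pose h (k : nat) := k%:Z - i.+1%:Z.
(* Level 0 contributes nothing; the other levels correspond to distinct jumps [h k], governed by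
   blocks of [A]. *)
rewrite (bigID (fun k => 0 < k)%N)/= [X in _ + X]big1 ?addr0; last first.
  by move=> [|k]//= _; rewrite /above_zero/= mulr0.
have -> : \sum_(k <- l | (0 < k)%N) P (i.+1, s) (k, j) * above_zero c (k, j) =
    (\sum_(z <- map h [seq k <- l | (0 < k)%N]) A z s j) * c j.
  by rewrite big_map big_filter mulr_suml; apply: eq_bigr => -[].
rewrite ler_wpM2r// -lee_fin -sumEFin block_sumE.
apply: (le_sum_esum (f := fun z => (A z s j)%:E)) => [|z].
  by rewrite map_inj_uniq ?filter_uniq// => a b /addIr[].
by rewrite lee_fin A_ge0.
Qed.

End GIG1Chain.

(** * The two implications *)

Section SubstochasticPowers.
Context {R : realType} {m : nat}.
Variable M : 'M[R]_m.
Hypotheses (M_ge0 : nonneg_mx M) (M_le1 : forall s, \sum_j M s j <= 1).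

Definition pow_row_sum t s : R := \sum_j (M ^+ t) s j.

Lemma exp_mx_ge0 t : nonneg_mx (M ^+ t).
Proof.
elim: t => [|t IH] i j; first by rewrite expr0 mxE ler0n.
by rewrite exprS -mulmxE mxE sumr_ge0// => k _; rewrite mulr_ge0.
Qed.

Lemma pow_row_sum0 s : pow_row_sum 0 s = 1.
Proof.
rewrite /pow_row_sum expr0 (bigD1 s)//= mxE eqxx big1 ?addr0// => j js.
by rewrite mxE eq_sym (negbTE js).
Qed.

Lemma pow_row_sumS t s : pow_row_sum t.+1 s = \sum_j M s j * pow_row_sum t j.
Proof.
rewrite /pow_row_sum exprS -mulmxE; under eq_bigr do rewrite mxE.
by rewrite exchange_big; apply: eq_bigr => j _; rewrite mulr_sumr.
Qed.

Lemma pow_row_sumSr t s :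
  pow_row_sum t.+1 s = \sum_j (M ^+ t) s j * \sum_k M j k.
Proof.
rewrite /pow_row_sum exprSr -mulmxE; under eq_bigr do rewrite mxE.
by rewrite exchange_big; apply: eq_bigr => j _; rewrite mulr_sumr.
Qed.

Lemma pow_row_sum_ge0 t s : 0 <= pow_row_sum t s.
Proof. by apply: sumr_ge0 => j _; exact: exp_mx_ge0. Qed.

Lemma pow_row_sum_nincr t u s : (t <= u)%N -> pow_row_sum u s <= pow_row_sum t s.
Proof.
elim: u => [|u IH]; first by rewrite leqn0 => /eqP ->.
rewrite leq_eqVlt => /predU1P[->//|/IH]; apply: le_trans.
rewrite pow_row_sumSr; apply: ler_sum => j _.
by rewrite -[leRHS]mulr1 ler_wpM2l// exp_mx_ge0.
Qed.

(** Some row [r] has sum below 1. Irreducibility leads from any [s] to [r] in some [t] steps, so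
    mass is lost at step [t.+1]. As row sums do not increase with the power, one [N] serves all
    phases. *)
Lemma pow_row_sum_lt1 : irreducible_mx M -> ~ stochastic_mx M ->
  exists N, forall s, pow_row_sum N s < 1.
Proof.
move=> M_irr M_nstoch.
have [r r_lt1] : exists r, \sum_k M r k < 1.
  apply: contrapT => nlt; apply: M_nstoch => i; apply/eqP.
  by rewrite eq_le M_le1 leNgt; apply/negP => i_lt1; apply: nlt; exists i.
have [s|N hN] := @fin_eventually 'I_m (fun s n => pow_row_sum n s < 1); last first.
  by exists N => s; exact: hN.
have [t str] := M_irr s r; exists t.+1 => n tn.
apply: le_lt_trans (pow_row_sum_nincr s tn) _.
apply: lt_le_trans (_ : pow_row_sum t s <= 1); last first.
  by rewrite -(pow_row_sum0 s); exact: pow_row_sum_nincr.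
(* The term of [r] drops strictly since [(M ^+ t) s r] is positive; the others do not grow. *)
rewrite pow_row_sumSr /pow_row_sum (bigD1 r)//= [ltRHS](bigD1 r)//=.
apply: ltr_leD; first by rewrite -[ltRHS]mulr1 ltr_pM2l.
by apply: ler_sum => j _; rewrite -[leRHS]mulr1 ler_wpM2l// exp_mx_ge0.
Qed.

End SubstochasticPowers.

(** * Uniform return to level 0, then escape to high levels *)

Section GIG1Ergodicity.
Context {R : realType} {m : nat}.
Variables (A B : int -> 'M[R]_m).
Hypotheses (m_gt0 : (0 < m)%N) (A_ge0 : forall k, nonneg_mx (A k)).

Local Notation P := (gig1_matrix A B).
Local Notation S := (nat * 'I_m)%type.

Hypothesis P_trans : is_transition_matrix P.

Local Notation T n := (iter n (markov_op P)).
Local Notation M := (block_sum A).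
Local Notation c t := (pow_row_sum M t).

Let M_ge0 := block_sum_ge0 A_ge0 P_trans.
Let M_le1 := block_sum_substochastic A_ge0 P_trans.
Let c_ge0 t s : 0 <= c t s. Proof. exact: pow_row_sum_ge0. Qed.

(** If level 0 is reached within [t] steps, the time left lies between [n] and [n + t], inside the
    window where [e] is a lower bound. The proof is by induction on [t], through the first step. *)
Lemma return_to_zero_bound (x0 : S) (K N : nat) (e : R) : 0 < e ->
  (forall s n, (K <= n <= K + N)%N -> e <= T n (hit x0) (0%N, s)) ->
  forall t x n, (K <= n)%N -> (n + t <= K + N)%N ->
    e * (1 - above_zero (c t) x) <= T (n + t) (hit x0) x.
Proof.
move=> e0 h; elim=> [|t IH] [[|i] s] n Kn ntN.
- by rewrite subr0 mulr1 h// ntN (leq_trans Kn)// leq_addr.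
- rewrite /above_zero/= pow_row_sum0 subrr mulr0 iter_markov_ge0//.
  exact: bounded_nonneg_bool.
- by rewrite subr0 mulr1 h// ntN (leq_trans Kn)// leq_addr.
have bh : bounded_nonneg (hit x0 : S -> R) by exact: bounded_nonneg_bool.
have ntN' : (n + t <= K + N)%N by rewrite (leq_trans _ ntN)// addnS.
have bT := iter_markov_bounded P_trans (n + t) bh.
have bc := above_zero_bounded (c_ge0 t).
rewrite addnS /=.
(* The induction hypothesis averaged over one step, with the subtracted term moved across so that
   all functions stay nonnegative. *)
have : e <= markov_op P (T (n + t) (hit x0)) (i.+1, s)
          + e * markov_op P (above_zero (c t)) (i.+1, s).
  rewrite /markov_op -(expectZ (P_trans _) (ltW e0) bc).
  rewrite -(expectD (P_trans _))//; last exact/bounded_nonnegZ/bc/ltW.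
  rewrite -[leLHS](expect_cst (P_trans (i.+1, s)) (ltW e0)).
  apply: le_expect => //; first by move=> ?; exact: ltW.
    by move=> z; have := IH z n Kn ntN'; lra.
  exact/bounded_nonnegD/bounded_nonnegZ/bc/ltW.
have := markov_above_zero_le A_ge0 P_trans i s (c_ge0 t).
rewrite -pow_row_sumS => /(ler_wpM2l (ltW e0)).
have -> : above_zero (c t.+1) (i.+1, s) = c t.+1 s by [].
by lra.
Qed.

Lemma gig1_strongly_ergodic : chain_irreducible P -> aperiodic P ->
  irreducible_mx M -> ~ stochastic_mx M -> strongly_ergodic P.
Proof.
move=> P_irr P_aper M_irr M_nstoch.
have [N cN] := pow_row_sum_lt1 M_ge0 M_le1 M_irr M_nstoch.
have [d d0 dc] := @fin_pos_lower_bound R 'I_m (fun s => 1 - c N s)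
  (fun s => ltac:(by rewrite subr_gt0)).
pose x0 : S := (0%N, Ordinal m_gt0).
(* The window exceeds [N] by one so that [K.+1] can replace [K], which may be 0: Doeblin's theorem
   requires a positive number of steps. *)
have [K [e [e0 eT]]] := eventually_positive_fin P_trans
  (fun s : 'I_m => (0%N, s)) x0 N.+1 P_irr P_aper.
have d1 : d <= 1.
  by apply: le_trans (dc (Ordinal m_gt0)) _; rewrite gerBl.
apply: (@doeblin_strongly_ergodic _ _ _ P_trans (K.+1 + N) (e * d) x0) => //.
  exact: mulr_gt0.
move=> x; have := @return_to_zero_bound x0 K N.+1 e e0 eT N x K.+1 (leqnSn K).
rewrite addSnnS => /(_ (leqnn _)); apply: le_trans.
rewrite ler_wpM2l ?(ltW e0)//.
case: x => -[|i] s; first by rewrite /above_zero/= subr0.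
exact: dc.
Qed.

Definition low (L : nat) (x : S) : R := (x.1 <= L)%N%:R.

Lemma low_bounded L : bounded_nonneg (low L).
Proof. exact: (@bounded_nonneg_bool _ _ (fun x : S => x.1 <= L)%N). Qed.

(** By stochasticity, finitely many jumps carry mass at least [1 - e] from phase [s]; from a high
    enough level they all end above [L]. *)
Lemma markov_low_small L (e : R) : stochastic_mx M -> 0 < e ->
  exists I, forall s i, (I <= i)%N -> markov_op P (low L) (i, s) <= e.
Proof.
move=> M_stoch e0.
apply: (@fin_eventually 'I_m (fun s i => markov_op P (low L) (i, s) <= e)) => s.
have [l ul le] : exists2 l : seq int, uniq l & 1 - e <= \sum_(z <- l) \sum_j A z s j.
  apply: contrapT => nl.
  suff : (1%:E <= (1 - e)%:E :> \bar R)%E by rewrite lee_fin; lra.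
  rewrite -{1}(M_stoch s) (block_sum_row A_ge0 P_trans); apply: esum_le_sum => l ul.
  rewrite sumEFin lee_fin leNgt; apply/negP => /ltW ?; apply: nl.
  by exists l.
have [I lI] := jumps_bounded l L; exists I => i Ii.
have := sum_jumps_le_expect P_trans s ul (fun z => lI i z Ii).
rewrite exchange_big => /(le_trans le).
have low01 x : 0 <= low L x <= 1 by rewrite ler0n lern1 leq_b1.
have := iter_markov_compl P_trans 1 (i, s) low01; rewrite /= => ->.
rewrite (_ : (fun x => 1 - low L x) = fun x => (L < x.1)%N%:R).
  by rewrite /markov_op; lra.
apply/funext => x; rewrite /low leqNgt; case: ltnP => _; first by rewrite subr0.
by rewrite subrr.
Qed.

(** Pointwise [T n (low L) <= low I1 + e / 2]: by induction from level [I1] on, and because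
    probabilities are at most 1 below it. One more step from high up makes the first term at most
    [e / 2]. *)
Lemma iter_markov_low_small n L (e : R) : stochastic_mx M -> 0 < e ->
  exists I, forall s i, (I <= i)%N -> T n (low L) (i, s) <= e.
Proof.
move=> M_stoch; elim: n e => [|n IH] e e0.
  exists L.+1 => s i Li; rewrite /= /low/= leqNgt Li; exact: ltW.
have e2 : 0 < e / 2 by rewrite divr_gt0.
have [I1 h1] := IH _ e2; have [I2 h2] := markov_low_small I1 M_stoch e2.
exists I2 => s i Ii.
have bl := low_bounded I1.
apply: (@le_trans _ _ (markov_op P (low I1) (i, s) + e / 2)); last first.
  by have := h2 s i Ii; lra.
rewrite /= /markov_op -[X in _ + X](expect_cst (P_trans (i, s)) (ltW e2)).
rewrite -(expectD (P_trans _))//; last exact/bounded_nonneg_cst/ltW.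
have bL := low_bounded L.
apply: le_expect => //.
- by move=> x; exact: iter_markov_ge0.
- move=> [k j]; rewrite /low/=; case: leqP => [_|Ik]; last first.
    by rewrite add0r; apply: h1; exact: ltnW.
  have /andP[_ T1] : 0 <= T n (low L) (k, j) <= 1.
    by apply: iter_markov_between => // x; rewrite ler0n lern1 leq_b1.
  by apply: le_trans T1 _; rewrite lerDl ltW.
- exact/bounded_nonnegD/bounded_nonneg_cst/ltW.
Qed.

(** A finite set [l] of [pi]-mass above 1/2 lies in levels up to [L]. At a time when every row is
    within 1/4 of [pi], a start from high enough gives [l] probability at most 1/8, yet 1/8 + 1/4 <
    1/2. *)
Lemma stochastic_not_strongly_ergodic : stochastic_mx M -> ~ strongly_ergodic P.
Proof.
move=> M_stoch [pi [pi0 pi1] tv0].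
have [l ul pil] : exists2 l : seq S, uniq l & 1/2 < \sum_(x <- l) pi x.
  apply: contrapT => nl.
  suff : (1%:E <= (1/2 : R)%:E :> \bar R)%E by rewrite lee_fin; lra.
  rewrite -pi1; apply: esum_le_sum => l ul.
  rewrite sumEFin lee_fin leNgt; apply/negP => ?; apply: nl.
  by exists l.
pose L := (\max_(x <- l) x.1)%N.
have [n tvn] : exists n, (ereal_sup [set \esum_(y in [set: S])
    `|nstep P n x y - (pi y)%:E| | x in [set: S]] < (1/4 : R)%:E)%E.
  have /tv0[n _ /(_ n (leqnn n))] : nbhs (0%E : \bar R) [set y | y < (1/4 : R)%:E]%E.
    apply: open_nbhs_nbhs; split; first exact: open_ereal_lt_ereal.
    by rewrite /= lte_fin; lra.
  by exists n.
have [I hI] := @iter_markov_low_small n L (1/8) M_stoch ltac:(lra).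
pose x : S := (I, Ordinal m_gt0).
have := hI x.2 I (leqnn I); rewrite -[(I, x.2)]/x.
have : \sum_(y <- l) T n (hit y) x <= T n (low L) x.
  rewrite -(iter_markov_sum P_trans); last by move=> y; exact: bounded_nonneg_bool.
  apply: le_iter_markov => //; last exact: low_bounded.
    by move=> z; case/andP: (sum_hit01 (R := R) z ul).
  move=> z; have [zl|zl] := boolP (z \in l).
    have /andP[_] := sum_hit01 (R := R) z ul.
    by rewrite /low leq_bigmax_seq.
  rewrite big_seq big1 ?ler0n// => y yl; rewrite /hit.
  by case: eqP => // zy; rewrite zy yl in zl.
have : \sum_(y <- l) `|T n (hit y) x - pi y| < 1/4.
  rewrite -lte_fin; apply: le_lt_trans tvn.
  apply: ereal_sup_ge; eexists; first by exists x.
  rewrite -sumEFin; under eq_bigr do rewrite -abse_EFin EFinB -nstepE//.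
  by apply: le_sum_esum.
have : \sum_(y <- l) pi y <=
    \sum_(y <- l) T n (hit y) x + \sum_(y <- l) `|T n (hit y) x - pi y|.
  rewrite -big_split/=; apply: ler_sum => y _.
  by rewrite -lerBlDl distrC ler_norm.
by move: pil; lra.
Qed.

End GIG1Ergodicity.

Theorem theorem4p1 (R : realType) (m : nat) (A B : int -> 'M[R]_m)
    (m_gt0 : (0 < m)%N)
    (A_ge0 : forall k : int, nonneg_mx (A k))
    (B_ge0 : forall k : int, nonneg_mx (B k))
    (P_stochastic : is_transition_matrix (gig1_matrix A B))
    (P_irreducible : chain_irreducible (gig1_matrix A B))
    (P_aperiodic : aperiodic (gig1_matrix A B))
    (A_irreducible : irreducible_mx (block_sum A)) :
  strongly_ergodic (gig1_matrix A B) <-> ~ stochastic_mx (block_sum A).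
Proof.
split; last exact: gig1_strongly_ergodic.
by move=> ergodic stoch; exact: stochastic_not_strongly_ergodic ergodic.
Qed.
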